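(* For even $m=2n>4$, write $C(m)$ for the supremum of $\operatorname{scl}(w)$ over all words $w$ in $\mathbb{Z}^\infty*\mathbb{Z}^\infty$ of reduced length $m$. Then this supremum is attained and satisfies $$C(m)\leq\begin{cases}\dfrac n2-1,&\text{if } n \text{ is odd},\\[2mm] \dfrac n2-\dfrac{(n-1)!-1}{n\,(n-2)!-2},&\text{if } n\text{ is even}.\end{cases}$$ Moreover, for every $\epsilon>0$ we have, for all sufficiently large (even) $m$, $$\frac m4-1\leq C(m)\leq\frac m4-1+\epsilon .$$
   Context: For a group $G$ and $g\in[G,G]$, $\operatorname{cl}(g)$ is the least number of commutators in $G$ whose product is $g$, and the stable commutator length is $\operatorname{scl}(g)=\lim_{k\to\infty}\operatorname{cl}(g^k)/k$. $\mathbb{Z}^\infty$ is the free abelian group on countably many generators. Write $A$ and $B$ for the left and right factor of the free product $\mathbb{Z}^\infty*\mathbb{Z}^\infty$. All words considered are elements of the commutator subgroup of $A*B$ which start in $A$ and end in $B$, i.e. have the form $w=u_1v_1\cdots u_nv_n$ with $u_i\in A\setminus\{1\}$ and $v_i\in B\setminus\{1\}$; the reduced length of such a $w$ is $2n$. *)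

(* Defs.v *)
From HB Require Import structures.
From mathcomp Require Import all_boot all_order all_algebra.
From mathcomp Require Import all_classical all_reals all_analysis.
From mathcomp Require Import freeg.

Set Implicit Arguments.
Unset Strict Implicit.
Unset Printing Implicit Defensive.

Import Order.TTheory GRing.Theory Num.Theory.
Import numFieldNormedType.Exports.

Local Open Scope classical_set_scope.
Local Open Scope group_scope.

(** The free product of two groups, as the set of reduced words: sequences of
    nontrivial letters taken alternately from the two factors. *)
Section FreeProduct.
Variables G H : groupType.
Implicit Types (x y : G + H) (s u v w : seq (G + H)).

Definition nontrivial_letter x :=
  match x with inl g => g != 1 | inr h => h != 1 end.

Definition is_left x := if x is inl _ then true else false.

Definition reduced_word s :=
  all nontrivial_letter s && sorted (fun x y => is_left x != is_left y) s.

Record freeprod := FreeProd {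
  fpword :> seq (G + H);
  fpwordP : reduced_word fpword }.

HB.instance Definition _ := [isSub for fpword].
HB.instance Definition _ := [Choice of freeprod by <:].

(* The reduced form of the letter [x] (which may be trivial) followed by the
   reduced word [s]. *)
Definition fpcons x s :=
  match x, s with
  | inl g, inl g' :: s' => if g * g' == 1 then s' else inl (g * g') :: s'
  | inr h, inr h' :: s' => if h * h' == 1 then s' else inr (h * h') :: s'
  | _, _ => if nontrivial_letter x then x :: s else s
  end.

Definition inv_letter x : G + H :=
  match x with inl g => inl g^-1 | inr h => inr h^-1 end.

Fact reduced_word_behead x s : reduced_word (x :: s) -> reduced_word s.
Proof.
case/andP=> /= /andP[_ a] p; rewrite /reduced_word a /=.
by case: s p {a} => //= y s /andP[].
Qed.

Fact fpcons_reduced x s : reduced_word s -> reduced_word (fpcons x s).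
Proof.
move=> rs; case: x => [g|h]; case: s rs => [|[g'|h'] s] rs /=;
  case: ifP => n1 //.
all: try exact: reduced_word_behead rs.
all: move: rs; rewrite /reduced_word /= n1 //=.
all: by case: s => [|y s] /andP[/andP[_ a] p]; apply/andP; split.
Qed.

Fact foldr_fpcons_reduced u v :
  reduced_word v -> reduced_word (foldr fpcons v u).
Proof. by move=> rv; elim: u => //= x u; apply: fpcons_reduced. Qed.

Fact fpcons_nontrivial x s :
  reduced_word (x :: s) -> fpcons x s = x :: s.
Proof.
by case: x => [g|h]; case: s => [|[g'|h'] s];
  rewrite /reduced_word //= ?andbF // => /andP[/andP[->]].
Qed.

Fact fpcons_inl1 s : reduced_word s -> fpcons (inl 1) s = s.
Proof.
case: s => [|[g|h] s] //=; rewrite ?eqxx // mul1g.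
by rewrite /reduced_word /= => /andP[/andP[/negPf->]].
Qed.

Fact fpcons_inr1 s : reduced_word s -> fpcons (inr 1) s = s.
Proof.
case: s => [|[g|h] s] //=; rewrite ?eqxx // mul1g.
by rewrite /reduced_word /= => /andP[/andP[/negPf->]].
Qed.

Fact fpcons_inlM g g' s : reduced_word s ->
  fpcons (inl g) (fpcons (inl g') s) = fpcons (inl (g * g')) s.
Proof.
case: s => [|[k|k] s] rs.
- rewrite /=; case: (eqVneq g' 1) => [->|n1] /=; first by rewrite mulg1.
  by case: eqVneq.
- rewrite /= -!mulgA; case: eqP => [->|n1] //.
  rewrite mulg1; move: (rs); rewrite /reduced_word /= => /andP[/andP[k1 _]].
  by case: s rs => [|[l|l] s] //=; rewrite ?eqxx /reduced_word /= ?andbF //;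
    case: (eqVneq g 1).
- rewrite /=; case: (eqVneq g' 1) => [->|n1] /=; first by rewrite mulg1.
  by case: eqVneq.
Qed.

Fact fpcons_inrM h h' s : reduced_word s ->
  fpcons (inr h) (fpcons (inr h') s) = fpcons (inr (h * h')) s.
Proof.
case: s => [|[k|k] s] rs.
- rewrite /=; case: (eqVneq h' 1) => [->|n1] /=; first by rewrite mulg1.
  by case: eqVneq.
- rewrite /=; case: (eqVneq h' 1) => [->|n1] /=; first by rewrite mulg1.
  by case: eqVneq.
- rewrite /= -!mulgA; case: eqP => [->|n1] //.
  rewrite mulg1; move: (rs); rewrite /reduced_word /= => /andP[/andP[k1 _]].
  by case: s rs => [|[l|l] s] //=; rewrite ?eqxx /reduced_word /= ?andbF //;
    case: (eqVneq h 1).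
Qed.

Fact foldr_fpcons x u v : reduced_word u -> reduced_word v ->
  foldr fpcons v (fpcons x u) = fpcons x (foldr fpcons v u).
Proof.
move=> ru rv; have rw s : reduced_word (foldr fpcons v s).
  exact: foldr_fpcons_reduced.
case: x => [g|h]; case: u ru => [|[g'|h'] u] ru.
1,3,4,5: by rewrite [X in foldr _ _ X]/=; case: eqVneq => [->|//];
  rewrite ?fpcons_inl1 ?fpcons_inr1.
- rewrite [X in foldr _ _ X]/= [foldr _ _ (_ :: _)]/= fpcons_inlM //.
  by case: eqVneq => [->|//]; rewrite fpcons_inl1.
- rewrite [X in foldr _ _ X]/= [foldr _ _ (_ :: _)]/= fpcons_inrM //.
  by case: eqVneq => [->|//]; rewrite fpcons_inr1.
Qed.

Definition fpone := @FreeProd [::] isT.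

Definition fpmul (u v : freeprod) : freeprod :=
  FreeProd (foldr_fpcons_reduced u (fpwordP v)).

Fact fpinv_reduced s : reduced_word s -> reduced_word (rev (map inv_letter s)).
Proof.
case/andP=> a p; rewrite /reduced_word all_rev all_map rev_sorted.
apply/andP; split.
  by apply: sub_all a => -[g|h] /=; rewrite invg_eq1.
rewrite sorted_map; apply: sub_sorted p => x y.
by case: x y => [g|h] [g'|h'].
Qed.

Definition fpinv (u : freeprod) : freeprod :=
  FreeProd (fpinv_reduced (fpwordP u)).

Fact fpmulA : associative fpmul.
Proof.
move=> [u ru] [v rv] [w rw]; apply: val_inj => /=.
elim: u {ru} => //= x u ->; rewrite foldr_fpcons //.
exact: foldr_fpcons_reduced.
Qed.

Fact fpmul1 : left_id fpone fpmul.
Proof. by move=> u; apply: val_inj. Qed.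

Fact fpmulr1 : right_id fpone fpmul.
Proof.
move=> [u ru]; apply: val_inj => /=; elim: u ru => //= x u IHu ru.
by rewrite IHu ?fpcons_nontrivial //; apply: reduced_word_behead ru.
Qed.

Fact fpcons_invK x s : reduced_word s ->
  fpcons (inv_letter x) (fpcons x s) = s.
Proof.
case: x => [g|h] rs; first by rewrite fpcons_inlM // mulVg fpcons_inl1.
by rewrite fpcons_inrM // mulVg fpcons_inr1.
Qed.

Fact fpmulV : left_inverse fpone fpinv fpmul.
Proof.
move=> [u ru]; apply: val_inj => /=; elim: u ru => //= x u IHu ru.
have ru' := reduced_word_behead ru.
rewrite rev_cons -cats1 foldr_cat /= -(fpcons_nontrivial ru) fpcons_invK //.
exact: IHu.
Qed.

Fact fpinvK : involutive fpinv.
Proof.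
move=> [u ru]; apply: val_inj; rewrite /= map_rev revK -map_comp.
by rewrite map_id_in // => -[g|h] _; rewrite /= invgK.
Qed.

Fact fpmulVr : right_inverse fpone fpinv fpmul.
Proof. by move=> u; rewrite -{1}[u]fpinvK fpmulV. Qed.

HB.instance Definition _ :=
  isGroup.Build freeprod fpmulA fpmul1 fpmulr1 fpmulV fpmulVr.

Fact fpletter_reduced x : reduced_word (fpcons x [::]).
Proof. exact: fpcons_reduced. Qed.

Definition fpinl (g : G) : freeprod := FreeProd (fpletter_reduced (inl g)).
Definition fpinr (h : H) : freeprod := FreeProd (fpletter_reduced (inr h)).

Fact fpinl1 : fpinl 1 = 1.
Proof. by apply: val_inj; rewrite /= eqxx. Qed.

Fact fpinlM : {morph fpinl : g g' / g * g'}.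
Proof.
move=> g g'; apply: val_inj.
by rewrite [RHS]foldr_fpcons ?fpcons_inlM ?fpletter_reduced.
Qed.

Fact fpinr1 : fpinr 1 = 1.
Proof. by apply: val_inj; rewrite /= eqxx. Qed.

Fact fpinrM : {morph fpinr : h h' / h * h'}.
Proof.
move=> h h'; apply: val_inj.
by rewrite [RHS]foldr_fpcons ?fpcons_inrM ?fpletter_reduced.
Qed.

HB.instance Definition _ := isMultiplicative.Build G freeprod fpinl fpinlM.
HB.instance Definition _ :=
  Multiplicative_isUMagmaMorphism.Build G freeprod fpinl fpinl1.
HB.instance Definition _ := isMultiplicative.Build H freeprod fpinr fpinrM.
HB.instance Definition _ :=
  Multiplicative_isUMagmaMorphism.Build H freeprod fpinr fpinr1.

End FreeProduct.

Arguments fpinl {G H} g.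
Arguments fpinr {G H} h.

Section CommutatorLength.
Variable G : groupType.
Implicit Types (g : G) (n : nat).

Definition derived_subgroup : set G :=
  smallest (fun S : set G => group_closed [in S])
           [set [~ x, y] | x in setT & y in setT].

Definition is_commutator_product n g : Prop :=
  exists s : n.-tuple (G * G), g = \prod_(p <- s) [~ p.1, p.2].

Lemma derived_subgroupP g :
  derived_subgroup g <-> exists n, is_commutator_product n g.
Proof.
split=> [dg | [n [[s _] /= ->]] S [S_gc S_comm]].
  suff: [set g | exists n, is_commutator_product n g] g by [].
  apply: dg; split=> [|_ [x _ [y _ <-]]]; last first.
    by exists 1%N, [tuple (x, y)]; rewrite big_seq1.
  split; first by rewrite inE; exists 0%N, [tuple]; rewrite big_nil.
  move=> u v; rewrite !inE => -[n [s ->]] [m [t ->]].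
  exists (n + m)%N, [tuple of s ++ [tuple of map (fun p => (p.2, p.1)) (rev t)]].
  rewrite /= big_cat /= big_map; congr (_ * _).
  by under eq_bigr do rewrite -invgR; rewrite prodgV invgK.
apply: (big_ind S) => [|x y Sx Sy|p _].
- by case: S_gc => + _; rewrite !inE.
- by have /(_ x y) := group_closedM S_gc; rewrite !inE => /(_ Sx Sy).
- by apply: S_comm; exists p.1 => //; exists p.2.
Qed.

(* The value 0 outside of the derived subgroup is a dummy. *)
Definition cl g : nat :=
  if pselect (exists n, `[< is_commutator_product n g >]) is left e
  then ex_minn e else 0.

Lemma clP g : derived_subgroup g ->
  is_commutator_product (cl g) g /\
  forall n, is_commutator_product n g -> cl g <= n.
Proof.
move=> /derived_subgroupP [n gn]; rewrite /cl; case: pselect => [e|[]].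
  by case: ex_minnP => k /asboolP gk k_min; split=> // j /asboolP /k_min.
by exists n; apply/asboolP.
Qed.

(* For [g] in the derived subgroup the limit exists, since
   [k |-> cl (g ^+ k)] is subadditive. *)
Definition scl (R : realType) g : R :=
  (limn (fun k => (cl (g ^+ k)%g)%:R / k%:R : R))%R.

End CommutatorLength.

(** The free abelian group on countably many generators. *)
Notation Zinfty := (Algebra.to_multiplicative {freeg nat}).

(** The elements of the commutator subgroup which start in the left factor and
    end in the right one, of reduced length [m]. *)
Definition words (m : nat) : set (freeprod Zinfty Zinfty) :=
  [set w | [/\ derived_subgroup w, size (fpword w) = m &
    exists n (u v : 'I_n -> Zinfty),
      [/\ forall i, u i != 1, forall i, v i != 1 &
          w = \prod_(i < n) (fpinl (u i) * fpinr (v i))]]].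

(* The supremum is taken in the extended reals, so that no default value
   interferes for an empty or unbounded set. *)
Definition C (R : realType) (m : nat) : \bar R :=
  ereal_sup [set (scl R w)%:E | w in words m].

(* Main.v *)
From HB Require Import structures.
Require Import Defs.
From mathcomp Require Import all_boot all_order all_algebra.
From mathcomp Require Import all_classical all_reals all_analysis.
From mathcomp Require Import freeg.
From mathcomp Require Import zify lra.

Set Implicit Arguments.
Unset Strict Implicit.
Unset Printing Implicit Defensive.

Import Order.TTheory GRing.Theory Num.Theory.
Import numFieldNormedType.Exports.

Local Open Scope classical_set_scope.
Local Open Scope ring_scope.

(** The word a_1 b_1 ... a_n b_n is called generic when the only relation
    between the a_i, and between the b_i, is that their product is 1.  Every
    word of length 2n in the commutator subgroup is the image of a fixed generic
    word under an endomorphism of the free product ([generic_image]), and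
    homomorphisms do not increase scl ([scl_morph]).  Hence C(2n) is attained,
    and it is the scl of the generic word ([C_generic]).  This number lies
    between n/2 - 1 and 7/6 for n = 4, and it equals n/2 - 1 for every other
    n > 2; the fraction that is subtracted from n/2 in the bound for even n is
    5/6 for n = 4 and at most 1 for larger n.

    Lower bound ([scl_generic_ge]).  Let a generic word have n - 1 letters of
    degree 1 and one of degree -(n - 1) on each side.  The sum, over the letters
    of a reduced word, of the signs of their degrees is an odd function on the
    free product whose defect is at most 1: in a product of two reduced words,
    what cancels contributes 0 by oddness, and at most one pair of letters
    merges.  So this sum is at most 4c on a product of c commutators
    ([letter_sum_product]), while it is 2(n - 2)k on the k-th power of the
    generic word.

    Upper bound ([scl_generic_le]).  Replacing a factor x y z by z y x costs one
    commutator ([comm_close_flip]); geometrically, a surface bounded by the word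
    is cut along two crossing arcs.  After a flip, letters of the same factor
    become neighbours, and a block of such letters with product 1 disappears: it
    bounds a disc.  With floor(n/2) flips any balanced word of n pairs vanishes
    ([alternating_product]), and for odd n the bound n/2 - 1 follows from
    scl <= cl - 1/2 ([stable_bound_product]).  One flip also turns a word of n
    pairs into one of n - 2 pairs ([merge_pairs_close]), so for even n > 4 it
    suffices to treat n = 6.  There the product of the word with one of its
    conjugates is a product of 4 commutators ([alternating_conj]), which gives
    scl <= 2 ([stable_bound_conj]).  For n = 4 the cube of the word is a product
    of 4 commutators ([alternating_cube]), so that scl <= (4 - 1/2) / 3. *)

(** * Words up to products of commutators *)

Section CommutatorProducts.
Local Open Scope group_scope.
Variable G : groupType.
Implicit Types (x y z g p q : G) (a b c d k m n : nat).

Lemma commutator_product_one c : is_commutator_product c (1 : G).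
Proof.
exists [tuple of nseq c (1, 1)]; rewrite /= big_nseq.
by elim: c => //= c <-; rewrite comm1g mul1g.
Qed.

Lemma commutator_productM c d x y : is_commutator_product c x ->
  is_commutator_product d y -> is_commutator_product (c + d) (x * y).
Proof. by move=> [s ->] [t ->]; exists [tuple of s ++ t]; rewrite big_cat. Qed.

Lemma commutator_product_comm x y : is_commutator_product 1 [~ x, y].
Proof. by exists [tuple (x, y)]; rewrite big_seq1. Qed.

Lemma commutator_product_le c d x : (c <= d)%N ->
  is_commutator_product c x -> is_commutator_product d x.
Proof.
move=> cd cx; rewrite -(subnKC cd) -[x]mulg1.
exact: commutator_productM cx (commutator_product_one _).
Qed.

Lemma commutator_productJ c x g :
  is_commutator_product c x -> is_commutator_product c (x ^ g).
Proof.
move=> [s ->]; exists [tuple of [seq (pr.1 ^ g, pr.2 ^ g) | pr : G * G <- s]].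
rewrite /= big_map conjg_prod; by apply: eq_bigr => pr _; rewrite conjRg.
Qed.

Lemma commutator_productV c x :
  is_commutator_product c x -> is_commutator_product c x^-1.
Proof.
move=> [s ->]; exists [tuple of [seq (pr.2, pr.1) | pr : G * G <- rev s]].
rewrite /= big_map -[tval s in LHS]revK -prodgV.
by apply: eq_bigr => pr _; rewrite invgR.
Qed.

Definition comm_close c x y := is_commutator_product c (y^-1 * x).

Lemma comm_close_refl x : comm_close 0 x x.
Proof. by rewrite /comm_close mulVg; apply: commutator_product_one. Qed.

Lemma comm_close_sym c x y : comm_close c x y -> comm_close c y x.
Proof. by move/commutator_productV; rewrite invgM invgK. Qed.

Lemma comm_close_trans c d x y z :
  comm_close c x y -> comm_close d y z -> comm_close (c + d) x z.
Proof.
move=> xy yz; rewrite /comm_close addnC.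
have -> : z^-1 * x = z^-1 * y * (y^-1 * x) by rewrite mulgA mulgK.
exact: commutator_productM.
Qed.

Lemma comm_close_eq c x y z : comm_close c x y -> y = z -> comm_close c x z.
Proof. by move=> + <-. Qed.

Lemma comm_closeM c d x y x' y' :
  comm_close c x y -> comm_close d x' y' ->
  comm_close (c + d) (x * x') (y * y').
Proof.
move=> xy xy'; rewrite /comm_close.
have -> : (y * y')^-1 * (x * x') = (y^-1 * x) ^ y' * (y'^-1 * x').
  by rewrite conjgE invgM !mulgA mulgK.
by apply: commutator_productM => //; apply: commutator_productJ.
Qed.

Lemma comm_close_ctx c p x y q :
  comm_close c x y -> comm_close c (p * x * q) (p * y * q).
Proof.
move=> xy; rewrite -[c]addn0 -[c]add0n.
by do 2?apply: comm_closeM => //; apply: comm_close_refl.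
Qed.

Lemma comm_closeX c x y k :
  comm_close c x y -> comm_close (k * c) (x ^+ k) (y ^+ k).
Proof.
move=> xy; elim: k => [|k IHk]; first exact: comm_close_refl.
by rewrite !expgS mulSn; apply: comm_closeM.
Qed.

Lemma comm_close_product c d x y : comm_close c x y ->
  is_commutator_product d y -> is_commutator_product (c + d) x.
Proof.
by move=> xy dy; rewrite -(mulVKg y x) addnC; apply: commutator_productM.
Qed.

Lemma comm_close_conj x g : comm_close 1 x (x ^ g).
Proof.
rewrite /comm_close -conjVg conjgE.
have -> : g^-1 * (x^-1 * g) * x = [~ g, x] by rewrite commgEl conjgE !mulgA.
exact: commutator_product_comm.
Qed.

(** The quotient of both sides is x^-1 y^-1 z^-1 x y z, the boundary word of a
    one-holed torus. *)
Lemma comm_close_flip x y z : comm_close 1 (x * y * z) (z * y * x).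
Proof.
rewrite /comm_close.
have -> : (z * y * x)^-1 * (x * y * z) = [~ y * x, x^-1 * z].
  by rewrite commgEl conjgE !invgM invgK !mulgA mulgK.
exact: commutator_product_comm.
Qed.

(** A power of a product is closer to the product of the powers than the obvious
    count k - 1 suggests, because one flip gains two exponents:
    (p q)^(k+2) = p q (p q)^k p q is k/2-close to p q p^k q^k p q, and flipping
    the outer letters of q (p^k q^k) p gives p^(k+2) q^(k+2).  The constant 1/2
    reflects that p, q and p q bound a pair of pants. *)
Lemma comm_closeXM p q k : comm_close k./2 ((p * q) ^+ k) (p ^+ k * q ^+ k).
Proof.
elim/ltn_ind: k p q => -[|[|k]] IHk p q.
- by rewrite !expg0 mulg1; apply: comm_close_refl.
- by rewrite !expg1; apply: comm_close_refl.
rewrite /= -add1n addnC.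
have -> : (p * q) ^+ k.+2 = (p * q) * (p * q) ^+ k * (p * q).
  by rewrite expgS expgSr mulgA.
apply: comm_close_trans (comm_close_ctx _ _ (IHk k _ p q)) _ => //.
have -> : p * q * (p ^+ k * q ^+ k) * (p * q) =
          p * (q * (p ^+ k * q ^+ k) * p) * q by rewrite !mulgA.
apply: comm_close_eq (comm_close_ctx _ _ (comm_close_flip _ _ _)) _.
rewrite [in RHS]expgS [in RHS]expgS.
by rewrite [q ^+ k.+2]expgSr [q ^+ k.+1]expgSr !mulgA.
Qed.

(** This is where scl <= cl - 1/2 comes from: [~ g, h] is the product of g^-1 and
    a conjugate of g, so its k-th power is k/2-close to the single commutator
    [~ g^k, h]. *)
Lemma commutator_product_exp c x k : is_commutator_product c.+1 x ->
  is_commutator_product (k * c + k./2 + 1) (x ^+ k).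
Proof.
case=> -[[|[g h] s] //= /eqP[sz_s]] ->; rewrite big_cons /=.
have close_gh :
    comm_close c ([~ g, h] * \prod_(pr <- s) [~ pr.1, pr.2]) [~ g, h].
  by rewrite /comm_close mulKg; exists (Tuple (introT eqP sz_s)).
rewrite -addnA; apply: comm_close_product (comm_closeX k close_gh) _.
rewrite commgEl; apply: comm_close_product (comm_closeXM _ _ _) _.
rewrite -conjXg expVgn -commgEl; exact: commutator_product_comm.
Qed.

(** A form of the inequality scl x <= a / m that makes sense for every x and
    survives, up to the obvious correction, the passage to a nearby element. *)
Definition stable_bound a m x :=
  exists b, forall k, is_commutator_product (a * k + b) (x ^+ (m * k)).

Lemma stable_bound_product c x :
  is_commutator_product c.+1 x -> stable_bound (c.*2.+1) 2 x.
Proof.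
move=> cx; exists 1%N => k.
have := commutator_product_exp (2 * k) cx.
by apply: commutator_product_le; lia.
Qed.

Lemma stable_bound_root a m n x :
  stable_bound a m (x ^+ n) -> stable_bound a (n * m) x.
Proof.
by move=> [b xb]; exists b => k; rewrite -mulnA expgnA.
Qed.

(** The product x * x ^ g has k-th power a product of about k (c + 1/2)
    commutators, and k/2 more separate it from x^k (x^g)^k, hence from x^(2k). *)
Lemma stable_bound_conj c x g :
  is_commutator_product c.+1 (x * x ^ g) -> stable_bound c.+1 2 x.
Proof.
move=> cx; exists 2%N => k; rewrite mul2n -addnn expgnDr.
have xk : comm_close (1 + k./2) (x ^+ k * x ^+ k) ((x * x ^ g) ^+ k).
  rewrite (_ : 1 + k./2 = 0 + 1 + k./2)%N //.
  apply: comm_close_trans (comm_close_sym (comm_closeXM _ _ _)).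
  rewrite -conjXg.
  exact: comm_closeM (comm_close_refl _) (comm_close_conj _ g).
apply: commutator_product_le
  (comm_close_product xk (commutator_product_exp k cx)).
by have := odd_double_half k; lia.
Qed.

Lemma stable_bound_close a c m x y : comm_close c x y ->
  stable_bound a m y -> stable_bound (m * c + a) m x.
Proof.
move=> xy [b yb]; exists b => k.
have -> : ((m * c + a) * k + b = m * k * c + (a * k + b))%N by nia.
exact: comm_close_product (comm_closeX _ xy) (yb k).
Qed.

End CommutatorProducts.

(** * The limit defining scl *)

(** Fekete's lemma, with the infimum as an explicit limit. *)
Section Fekete.
Variables (R : realType) (u : nat -> R).
Hypotheses (u_ge0 : forall k, 0 <= u k)
  (u_subadd : forall j k, u (j + k)%N <= u j + u k).

Let L := inf [set u k / k%:R | k in [set k | (0 < k)%N]].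

Lemma subadditive_mul q k : u (k * q)%N <= k%:R * u q + u 0%N.
Proof.
elim: k => [|k IHk]; first by rewrite !mul0r add0r.
rewrite mulSn (le_trans (u_subadd _ _)) // -natr1 mulrDl mul1r.
by rewrite addrAC [leRHS]addrC lerD2l.
Qed.

Let has_inf_ratio : has_inf [set u k / k%:R | k in [set k | (0 < k)%N]].
Proof.
split; first by exists (u 1%N / 1%:R), 1%N.
by exists 0 => _ [k _ <-]; rewrite divr_ge0.
Qed.

Lemma fekete_le k : (0 < k)%N -> L <= u k / k%:R.
Proof. by move=> k0; apply: ge_inf; [case: has_inf_ratio | exists k]. Qed.

Lemma fekete : (fun k => u k / k%:R) @ \oo --> L.
Proof.
apply/cvgrPdist_le => e e0.
have e2 : 0 < e / 2 by rewrite divr_gt0.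
have [_ [q q0 <-] Lq] := inf_adherent e2 has_inf_ratio.
rewrite -/L in Lq.
have uq0 : 0 < q%:R :> R by rewrite ltr0n.
(* Write k = (k / q) q + r with r < q; M bounds u r plus one more
   error term u 0. *)
pose M := u 0%N + q%:R * u 1%N + u 0%N.
have M0 : 0 <= M by rewrite !addr_ge0 ?mulr_ge0.
near=> k.
have k0 : (0 < k)%N by near: k; exact: nbhs_infty_gt.
have k0' : 0 < k%:R :> R by rewrite ltr0n.
rewrite ler0_norm ?subr_le0 ?fekete_le // opprB lerBlDr.
have uk : u k <= (k %/ q)%:R * u q + M.
  rewrite {1}(divn_eq k q) (le_trans (u_subadd _ _)) // /M !addrA -addrA.
  rewrite lerD ?subadditive_mul //.
  rewrite -[X in u X]muln1 (le_trans (subadditive_mul _ _)) //.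
  by rewrite lerD2r ler_wpM2r // ler_nat ltnW // ltn_mod.
have kq : (k %/ q)%:R * u q <= k%:R * (u q / q%:R).
  rewrite mulrCA [leLHS]mulrC ler_wpM2l // ler_pdivlMr // -natrM ler_nat.
  exact: leq_divM.
rewrite ler_pdivrMr // (le_trans uk) //.
have -> : (e + L) * k%:R = k%:R * (L + e / 2) + k%:R * (e / 2) by lra.
apply: lerD; first by rewrite (le_trans kq) // ler_wpM2l // ltW.
rewrite -ler_pdivrMr //; near: k.
exact: nbhs_infty_ger.
Unshelve. all: end_near. Qed.

End Fekete.

Section StableCommutatorLength.
Variables (R : realType) (G : groupType).
Implicit Types (g h w x : G) (c k m n : nat).

Lemma derived_subgroup_product c x :
  is_commutator_product c x -> derived_subgroup x.
Proof. by move=> cx; apply/derived_subgroupP; exists c. Qed.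

Lemma cl_le c x : is_commutator_product c x -> (cl x <= c)%N.
Proof.
by move=> cx; case: (clP (derived_subgroup_product cx)) => _; apply.
Qed.

Lemma cl_product x : derived_subgroup x -> is_commutator_product (cl x) x.
Proof. by case/clP. Qed.

Lemma derived_subgroupX x k :
  derived_subgroup x -> derived_subgroup (x ^+ k)%g.
Proof.
move=> /cl_product dx; apply: (@derived_subgroup_product (k * cl x)).
have x1 : comm_close (cl x) x 1%g by rewrite /comm_close invg1 mul1g.
have := comm_closeX k x1; rewrite expg1n => xk.
rewrite -[(k * _)%N]addn0.
exact: comm_close_product xk (commutator_product_one _ _).
Qed.

Section Limit.
Variables (w : G) (dw : derived_subgroup w).

Let u k : R := (cl (w ^+ k)%g)%:R.

Let u_subadd j k : u (j + k)%N <= u j + u k.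
Proof.
rewrite -natrD ler_nat; apply: cl_le; rewrite expgnDr.
by apply: commutator_productM; apply: cl_product; apply: derived_subgroupX.
Qed.

Lemma cvg_scl : cvgn (fun k => (cl (w ^+ k)%g)%:R / k%:R : R).
Proof. by apply/cvg_ex; eexists; apply: (@fekete R u). Qed.

Lemma scl_le_cl k : (0 < k)%N -> scl R w <= (cl (w ^+ k)%g)%:R / k%:R.
Proof.
move=> k0; rewrite /scl.
have u0 j : 0 <= u j by [].
rewrite (cvg_lim (@Rhausdorff R) (fekete u0 u_subadd)).
exact: (fekete_le u0).
Qed.

Lemma scl_ge (r : R) :
  (forall k, r * k%:R <= (cl (w ^+ k)%g)%:R) -> r <= scl R w.
Proof.
move=> rw; apply: limr_ge; first exact: cvg_scl.
near=> k.
have k0 : (0 < k)%N by near: k; exact: nbhs_infty_gt.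
by rewrite ler_pdivlMr ?ltr0n.
Unshelve. all: end_near. Qed.

(** Since scl is the infimum of cl (w ^+ k) / k, the additive constant in
    [stable_bound] is absorbed along the multiples of m. *)
Lemma scl_stable_bound a m :
  (0 < m)%N -> stable_bound a m w -> scl R w <= a%:R / m%:R.
Proof.
move=> m0 [b wb]; have m0' : 0 < m%:R :> R by rewrite ltr0n.
rewrite leNgt; apply/negP => lt_scl.
pose d := scl R w * m%:R - a%:R.
have d0 : 0 < d by rewrite subr_gt0 -ltr_pdivrMr.
have [k kb] : exists k : nat, b%:R / d < k%:R.
  exists (Num.bound (b%:R / d)).
  by apply: archi_boundP; rewrite divr_ge0 // ltW.
have k0 : (0 < k)%N.
  by rewrite -(ltr_nat R) (le_lt_trans _ kb) // divr_ge0 // ltW.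
have mk0 : (0 < m * k)%N by rewrite muln_gt0 m0.
have := scl_le_cl mk0; rewrite ler_pdivlMr ?ltr0n //.
have : (cl (w ^+ (m * k))%g)%:R <= (a * k + b)%:R :> R by rewrite ler_nat cl_le.
move: kb; rewrite ltr_pdivrMr // /d natrD !natrM; nra.
Qed.

End Limit.

End StableCommutatorLength.

Section Homomorphism.
Variables (R : realType) (G H : groupType) (f : G -> H).
Hypothesis fM : {morph f : x y / (x * y)%g}.

Lemma morph1 : f 1%g = 1%g.
Proof. by apply: (mulgI (f 1%g)); rewrite -fM !mulg1. Qed.

Lemma morphV x : f x^-1%g = (f x)^-1%g.
Proof. by apply: (mulgI (f x)); rewrite -fM !mulgV morph1. Qed.

Lemma morphX x k : f (x ^+ k)%g = (f x ^+ k)%g.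
Proof. by elim: k => [|k IHk]; rewrite ?morph1 // !expgS fM IHk. Qed.

Lemma morph_commutator_product c x :
  is_commutator_product c x -> is_commutator_product c (f x).
Proof.
move=> [s ->]; exists [tuple of [seq (f pr.1, f pr.2) | pr : G * G <- s]].
rewrite /= big_map (big_morph f fM morph1); apply: eq_bigr => pr _ /=.
by rewrite !commgEl !conjgE !fM !morphV.
Qed.

Lemma scl_morph x : derived_subgroup x -> scl R (f x) <= scl R x.
Proof.
move=> dx; have dfx : derived_subgroup (f x).
  apply: derived_subgroup_product.
  exact: morph_commutator_product (cl_product dx).
apply: ler_lim; [exact: cvg_scl | exact: cvg_scl |].
near=> k; rewrite ler_wpM2r ?invr_ge0 // ler_nat cl_le // -morphX.
by apply: morph_commutator_product; apply: cl_product; apply: derived_subgroupX.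
Unshelve. all: end_near. Qed.

End Homomorphism.

(** * Balanced alternating words *)

Section AlternatingWords.
Local Open Scope group_scope.
Variables (G : groupType) (A B : zmodType) (α : A -> G) (β : B -> G).
Hypotheses (αD : {morph α : x y / (x + y)%R >-> x * y})
           (βD : {morph β : x y / (x + y)%R >-> x * y}).
Implicit Types (s t : seq (A * B)) (p : A * B).

Definition alternating s : G := \prod_(p <- s) (α p.1 * β p.2).

Definition balanced s :=
  (\sum_(p <- s) p.1 == 0)%R && (\sum_(p <- s) p.2 == 0)%R.

Lemma alpha0 : α 0%R = 1.
Proof. by apply: (mulgI (α 0%R)); rewrite -αD addr0 mulg1. Qed.

Lemma beta0 : β 0%R = 1.
Proof. by apply: (mulgI (β 0%R)); rewrite -βD addr0 mulg1. Qed.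

Lemma alternating_cons p s :
  alternating (p :: s) = α p.1 * β p.2 * alternating s.
Proof. by rewrite /alternating big_cons. Qed.

(** Flipping a2, b2 a3 and b3 brings b1, b2 and b3 together, and also a2
    and a3. *)
Lemma alternating_merge a1 a2 a3 b1 b2 b3 t :
  comm_close 1 (alternating [:: (a1, b1), (a2, b2), (a3, b3) & t])
    (α a1 * β (b1 + b2 + b3)%R * α (a2 + a3)%R * alternating t).
Proof.
rewrite !alternating_cons /= !mulgA.
have -> : α a1 * β b1 * α a2 * β b2 * α a3 * β b3 * alternating t =
  α a1 * β b1 * (α a2 * (β b2 * α a3) * β b3) * alternating t.
  by rewrite !mulgA.
apply: comm_close_eq (comm_close_ctx _ _ (comm_close_flip _ _ _)) _.
by rewrite -addrA [(b2 + b3)%R]addrC [(a2 + a3)%R]addrC !αD !βD !mulgA.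
Qed.

(** The pairs of the word obtained by that flip, when a fourth pair follows to
    absorb a2 and a3. *)
Definition merge_pairs s :=
  if s is [:: p1, p2, p3, p4 & t] then
    [:: (p1.1, p1.2 + p2.2 + p3.2), (p2.1 + p3.1 + p4.1, p4.2) & t]%R
  else s.

Lemma merge_pairs_balanced s : balanced (merge_pairs s) = balanced s.
Proof.
case: s => [|p1 [|p2 [|p3 [|p4 t]]]] //=.
by rewrite /balanced !big_cons /= !addrA.
Qed.

Lemma merge_pairs_size s :
  (3 < size s)%N -> size (merge_pairs s) = (size s - 2)%N.
Proof. by case: s => [|p1 [|p2 [|p3 [|p4 t]]]] //=; rewrite subn2. Qed.

Lemma merge_pairs_close s :
  (3 < size s)%N -> comm_close 1 (alternating s) (alternating (merge_pairs s)).
Proof.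
case: s => [|[a1 b1] [|[a2 b2] [|[a3 b3] [|[a4 b4] t]]]] //= _.
apply: comm_close_eq (alternating_merge _ _ _ _ _ _ _) _.
by rewrite !alternating_cons /= [α (_ + _ + _)%R]αD !mulgA.
Qed.

(** Two pairs disappear for each commutator; words of two or three pairs
    are treated by a single flip. *)
Lemma alternating_product s :
  balanced s -> is_commutator_product (size s)./2 (alternating s).
Proof.
have [n le_sn] := ubnP (size s).
elim: n s le_sn => // n IHn [|[a1 b1] [|[a2 b2] [|[a3 b3] [|p4 t]]]] le_sn.
- by rewrite /alternating big_nil => _; apply: commutator_product_one.
- rewrite /balanced /alternating !big_seq1 /= => /andP[/eqP-> /eqP->].
  by rewrite alpha0 beta0 mulg1; apply: commutator_product_one.
- rewrite /balanced !big_cons !big_nil !addr0 /= => /andP[/eqP a12 /eqP b12].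
  rewrite /alternating !big_cons big_nil mulg1 /=.
  have -> : α a1 * β b1 * (α a2 * β b2) = α a1 * (β b1 * α a2) * β b2.
    by rewrite !mulgA.
  rewrite /comm_close -[1%N]addn0.
  apply: comm_close_product (comm_close_flip _ _ _) _.
  rewrite !mulgA -βD -mulgA -αD addrC b12 beta0 addrC a12 alpha0 mulg1.
  exact: commutator_product_one.
- rewrite /balanced !big_cons !big_nil !addr0 /= => /andP[/eqP a123 /eqP b123].
  rewrite -[1%N]addn0.
  apply: comm_close_product (alternating_merge _ _ _ _ _ _ _) _.
  rewrite /alternating big_nil mulg1 -addrA b123 beta0 mulg1 -αD a123 alpha0.
  exact: commutator_product_one.
move=> bal_s.
set s := [:: _, _, _, _ & t] in le_sn bal_s *.
have s4 : (3 < size s)%N by [].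
have := @IHn (merge_pairs s).
rewrite merge_pairs_balanced merge_pairs_size // => /(_ _ bal_s) IHs.
apply: commutator_product_le
  (comm_close_product (merge_pairs_close s4) (IHs _)).
  by lia.
by lia.
Qed.

(** ** Certificates *)

Variable s : seq (A * B).
Let n := size s.
Hypothesis bal_s : balanced s.

(** Letters are named by their factor (true for the right one) and their position
    in s, so that rewriting of words can be carried out by computation. *)
Definition letter_value (l : bool * nat) : G :=
  if l.1 then β (nth (0, 0)%R s l.2).2 else α (nth (0, 0)%R s l.2).1.

Definition word_value (w : seq (bool * nat)) : G :=
  \prod_(l <- w) letter_value l.

Lemma word_value_cat u v : word_value (u ++ v) = word_value u * word_value v.
Proof. exact: big_cat. Qed.

Lemma word_value_side c (r : seq nat) : word_value [seq (c, i) | i <- r] =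
  if c then β (\sum_(i <- r) (nth (0, 0) s i).2)%R
  else α (\sum_(i <- r) (nth (0, 0) s i).1)%R.
Proof.
rewrite /word_value big_map; case: c => /=.
  by rewrite (big_morph β βD beta0).
by rewrite (big_morph α αD alpha0).
Qed.

(** A block of letters of one factor in which each of the m letters of that
    factor occurs exactly q times: it bounds a disc because the word is
    balanced. *)
Definition is_disc m (q : nat) (c : bool) (w : seq (bool * nat)) :=
  perm_eq w [seq (c, i) | i <- flatten (nseq q (iota 0 m))].

Lemma disc_value q c w : is_disc n q c w -> word_value w = 1.
Proof.
move=> w_disc.
have -> : w = [seq (c, i) | i <- [seq l.2 | l <- w]].
  rewrite -map_comp map_id_in // => l.
  by rewrite (perm_mem w_disc) => /mapP[i _ ->].
have w_perm : perm_eq [seq l.2 | l <- w] (flatten (nseq q (iota 0 n))).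
  have -> : flatten (nseq q (iota 0 n)) =
      [seq l.2 | l <- [seq (c, i) | i <- flatten (nseq q (iota 0 n))]].
    by rewrite -map_comp map_id_in.
  exact: perm_map.
have sum_perm (V : zmodType) (F : nat -> V) : (\sum_(0 <= i < n) F i = 0 ->
    \sum_(i <- [seq l.2 | l <- w]) F i = 0)%R.
  rewrite /index_iota subn0 => F0; rewrite (perm_big _ w_perm) /=.
  elim: q {w_disc w_perm} => [|q IHq]; first by rewrite big_nil.
  by rewrite /= big_cat /= IHq addr0.
case/andP: bal_s; rewrite !(big_nth (0, 0)%R) => /eqP s1 /eqP s2.
by rewrite word_value_side !sum_perm // alpha0 beta0 if_same.
Qed.

Definition alternating_word m : seq (bool * nat) :=
  flatten [seq [:: (false, i); (true, i)] | i <- iota 0 m].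

Lemma alternating_value : alternating s = word_value (alternating_word n).
Proof.
rewrite /alternating (big_nth (0, 0)%R) /word_value big_flatten big_map /=.
rewrite /index_iota subn0; apply: eq_bigr => i _.
by rewrite !big_cons big_nil mulg1.
Qed.

(** [Flip p x y z] skips p letters and reverses the order of the next three
    blocks, of lengths x, y and z; [Drop p q c] skips p letters and removes a
    disc of multiplicity q in the factor c. *)
Variant move :=
  | Flip of nat & nat & nat & nat
  | Drop of nat & nat & bool.

Definition is_flip m := if m is Flip _ _ _ _ then true else false.

Fixpoint unravels m (ms : seq move) (w : seq (bool * nat)) : bool :=
  match ms with
  | [::] => nilp w
  | Flip p x y z :: ms' =>
    let X := drop p w in let Y := drop x X in let Z := drop y Y in
    unravels m ms' (take p w ++ take z Z ++ take y Y ++ take x X ++ drop z Z)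
  | Drop p q c :: ms' =>
    let D := drop p w in
    is_disc m q c (take (q * m) D) &&
    unravels m ms' (take p w ++ drop (q * m) D)
  end.

Lemma unravels_product ms w :
  unravels n ms w -> is_commutator_product (count is_flip ms) (word_value w).
Proof.
have flip_ctx (u x y z v : G) :
    comm_close 1 (u * x * y * z * v) (u * z * y * x * v).
  have := comm_close_ctx u v (comm_close_flip x y z).
  by rewrite !mulgA.
elim: ms w => [|[p x y z|p q c] ms IHms] w /=.
- by move=> /nilP->; rewrite /word_value big_nil; apply: commutator_product_one.
- move=> /IHms; apply: comm_close_product.
  rewrite -{1}(cat_take_drop p w) -{1}(cat_take_drop x (drop p w)).
  rewrite -{1}(cat_take_drop y (drop x _)) -{1}(cat_take_drop z (drop y _)).
  by rewrite !word_value_cat !mulgA; apply: flip_ctx.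
- case/andP=> /disc_value D1 /IHms; rewrite -{3}(cat_take_drop p w).
  by rewrite -{2}(cat_take_drop (q * n) (drop p w)) !word_value_cat D1 mul1g.
Qed.

End AlternatingWords.

Section StableBounds.
Local Open Scope group_scope.
Variables (G : groupType) (A B : zmodType) (α : A -> G) (β : B -> G).
Hypotheses (αD : {morph α : x y / (x + y)%R >-> x * y})
           (βD : {morph β : x y / (x + y)%R >-> x * y}).
Implicit Types s : seq (A * B).

(** The moves come from a surface of genus 4 bounded by the cube.  It is glued
    along 12 arcs from five discs, each on one side: four of them meet every
    letter of their side once, and the last one meets every letter of its side
    twice.  So its Euler characteristic is 5 - 12 = -7.  Each flip cuts it along
    two crossing arcs; what is left are the five discs, nested in one another. *)
Lemma alternating_cube s : balanced s -> size s = 4%N ->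
  is_commutator_product 4 (alternating α β s ^+ 3).
Proof.
move=> bal_s s4.
rewrite expgS expg2 alternating_value s4 -!word_value_cat.
apply: (unravels_product αD βD bal_s (ms := [::
  Flip 0 1 2 9; Flip 1 4 12 4; Flip 2 1 3 8; Flip 3 1 14 4;
  Drop 5 1 true; Drop 4 1 false; Drop 6 1 false; Drop 7 1 false;
  Drop 0 2 true])).
by rewrite s4; vm_compute.
Qed.

(** The surface is now glued along 12 arcs from four discs, each meeting every
    letter of its side once.  Its Euler characteristic is -8, and it has two
    boundary components, each reading the word once.  Cutting it along an arc
    that joins these components leaves a surface of genus 4, bounded by the
    product of the word with the rotation of it that starts at its tenth
    letter. *)
Lemma alternating_conj s : balanced s -> size s = 6%N ->
  exists g,
    is_commutator_product 4 (alternating α β s * alternating α β s ^ g).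
Proof.
move=> bal_s s6.
rewrite alternating_value s6 -{2}(cat_take_drop 9 (alternating_word 6)).
set u := take _ _; set v := drop _ _.
exists (word_value α β s u).
rewrite [word_value _ _ _ (u ++ v)]word_value_cat conjgE -!mulgA mulKg.
rewrite -!word_value_cat.
apply: (unravels_product αD βD bal_s (ms := [::
  Flip 1 1 17 1; Flip 3 1 2 10; Flip 4 1 5 4; Flip 6 3 9 3;
  Drop 11 1 true; Drop 10 1 false; Drop 5 1 true; Drop 0 1 false])).
by rewrite s6; vm_compute.
Qed.

Lemma alternating_stable_bound s : balanced s -> (2 < size s)%N ->
  size s <> 4%N -> stable_bound (size s - 2) 2 (alternating α β s).
Proof.
have [n le_sn] := ubnP (size s).
elim: n s le_sn => // n IHn s le_sn bal_s s2 s4.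
case/boolP: (odd (size s)) => [odd_s | even_s].
  have := alternating_product αD βD bal_s.
  have -> : ((size s)./2 = (size s)./2.-1.+1)%N by lia.
  move/stable_bound_product; congr stable_bound; lia.
have [s6|s6] := eqVneq (size s) 6%N.
  rewrite s6; have [g] := alternating_conj bal_s s6.
  exact: stable_bound_conj.
have s3 : (3 < size s)%N by lia.
have -> : (size s - 2 = 2 * 1 + (size (merge_pairs s) - 2))%N.
  by rewrite merge_pairs_size //; lia.
apply: stable_bound_close (merge_pairs_close αD βD s3) _.
by apply: IHn; rewrite ?merge_pairs_balanced ?merge_pairs_size //; lia.
Qed.

End StableBounds.

(** * Free products: universal property and quasimorphisms *)

Section FreeProducts.
Local Open Scope group_scope.
Variables (G H : groupType).
Implicit Types (w : freeprod G H) (s : seq (G * H)) (u v : seq (G + H)).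

Section Lift.
Variables (K : groupType) (f : G -> K) (g : H -> K).
Hypotheses (fM : {morph f : x y / x * y}) (gM : {morph g : x y / x * y}).

Definition fplift w : K :=
  \prod_(x <- fpword w) match x with inl a => f a | inr b => g b end.

Lemma fplift_fpcons x u :
  \prod_(y <- fpcons x u) (match y with inl a => f a | inr b => g b end) =
  \prod_(y <- x :: u) (match y with inl a => f a | inr b => g b end).
Proof.
have f1 := morph1 fM; have g1 := morph1 gM.
case: x u => [a|b] [|[a'|b'] u] //=; case: eqP => [e|_] //=;
  rewrite !big_cons ?big_nil ?mulgA -?fM -?gM ?e ?f1 ?g1 ?mul1g //.
Qed.

Lemma fpliftM : {morph fplift : x y / x * y}.
Proof.
move=> [u ru] [v rv]; rewrite /fplift /= -big_cat /=.
by elim: u {ru} => //= x u IHu; rewrite fplift_fpcons !big_cons IHu.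
Qed.

Lemma fplift_inl a : fplift (fpinl a) = f a.
Proof.
rewrite /fplift /=; case: eqP => [->|_]; rewrite ?big_seq1 //.
by rewrite big_nil (morph1 fM).
Qed.

Lemma fplift_inr b : fplift (fpinr b) = g b.
Proof.
rewrite /fplift /=; case: eqP => [->|_]; rewrite ?big_seq1 //.
by rewrite big_nil (morph1 gM).
Qed.

End Lift.

Lemma foldr_fpcons_cat u v :
  reduced_word (u ++ v) -> foldr (@fpcons _ _) v u = u ++ v.
Proof.
elim: u => //= x u IHu rx; rewrite IHu ?fpcons_nontrivial //.
exact: reduced_word_behead rx.
Qed.

Lemma fpword_inl a w : fpword (fpinl a * w) = fpcons (inl a) w.
Proof. exact: foldr_fpcons (isT : reduced_word [::]) (fpwordP w). Qed.

Lemma fpword_inr b w : fpword (fpinr b * w) = fpcons (inr b) w.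
Proof. exact: foldr_fpcons (isT : reduced_word [::]) (fpwordP w). Qed.

Definition nontrivial_pairs s := all (fun p => (p.1 != 1) && (p.2 != 1)) s.

Definition pairs_word s : seq (G + H) :=
  flatten [seq [:: inl p.1; inr p.2] | p <- s].

Lemma size_pairs_word s : size (pairs_word s) = (2 * size s)%N.
Proof. by elim: s => //= p s ->; rewrite mulnS. Qed.

Lemma pairs_word_reduced s : nontrivial_pairs s -> reduced_word (pairs_word s).
Proof.
move=> nt_s; rewrite /reduced_word; apply/andP; split.
  by elim: s nt_s => //= -[a b] s IHs /andP[/andP[/= -> ->]] /IHs.
case: s nt_s => //= -[a b] s _ /=.
by elim: s b => //= -[a' b'] s IHs b; apply: IHs.
Qed.

Lemma fpword_pairs s : nontrivial_pairs s ->
  fpword (\prod_(p <- s) (fpinl p.1 * fpinr p.2)) = pairs_word s.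
Proof.
elim: s => [|[a b] s IHs] nt_s; first by rewrite big_nil.
have /= /andP[/andP[a1 b1] nt_s'] := nt_s.
rewrite big_cons -mulgA.
transitivity (fpcons (inl a) (fpcons (inr b) (pairs_word s))).
  by rewrite -(IHs nt_s') fpword_inl fpword_inr.
have r_s := pairs_word_reduced nt_s.
rewrite [fpcons (inr b) _]fpcons_nontrivial.
  exact: fpcons_nontrivial.
exact: reduced_word_behead r_s.
Qed.

Lemma reduced_word_prefix u v : reduced_word (u ++ v) -> reduced_word u.
Proof.
by case/andP; rewrite all_cat => /andP[u1 _] /cat_sorted2[u2 _]; apply/andP.
Qed.

Lemma reduced_word_cat u (x y : G + H) v : Defs.is_left x != Defs.is_left y ->
  reduced_word (rcons u x) -> reduced_word (y :: v) ->
  reduced_word (rcons u x ++ y :: v).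
Proof.
move=> xy /andP[ux sx] /andP[yv sy]; rewrite /reduced_word all_cat ux yv /=.
case: u sx {ux} => [|z u] /= sx; first by rewrite xy.
by rewrite cat_path sx last_rcons /= xy.
Qed.

Lemma reduced_word_replace u (x y z : G + H) v :
  Defs.is_left x = Defs.is_left z -> Defs.is_left y = Defs.is_left z ->
  nontrivial_letter z -> reduced_word (rcons u x) -> reduced_word (y :: v) ->
  reduced_word (u ++ z :: v).
Proof.
move=> xz yz z1 /andP[ux sx] /andP[/= /andP[_ yv] sy].
have sz : path (fun p q => Defs.is_left p != Defs.is_left q) z v.
  by case: v sy {yv} => //= q v; rewrite yz.
apply/andP; split.
  by move: ux; rewrite all_rcons all_cat /= z1 yv => /andP[_ ->].
case: u sx {ux} => //= p u; rewrite rcons_path cat_path /= xz.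
by case/andP=> -> ->.
Qed.

(** Odd functions of defect at most 1 on the two factors add up to an odd
    function of defect at most 1 on the free product. *)
Section Quasimorphism.
Variables (f : G -> int) (g : H -> int).
Hypotheses (fV : forall x, f x^-1 = (- f x)%R)
           (gV : forall x, g x^-1 = (- g x)%R).
Hypotheses (f_defect : forall x y, (`|f (x * y) - f x - f y| <= 1)%R)
           (g_defect : forall x y, (`|g (x * y) - g x - g y| <= 1)%R).

Definition letter_sum u : int :=
  (\sum_(x <- u) match x with inl a => f a | inr b => g b end)%R.

Lemma letter_sum_cat u v :
  letter_sum (u ++ v) = (letter_sum u + letter_sum v)%R.
Proof. exact: big_cat. Qed.

Lemma letter_sum_seq1 x :
  letter_sum [:: x] = match x with inl a => f a | inr b => g b end.
Proof. exact: big_seq1. Qed.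

Lemma letter_sum_pairs s :
  letter_sum (pairs_word s) = (\sum_(p <- s) (f p.1 + g p.2))%R.
Proof.
rewrite /letter_sum big_flatten big_map; apply: eq_bigr => p _ /=.
by rewrite !big_cons big_nil /= addr0.
Qed.

(** Induction on the number of letters that cancel between u and v. *)
Lemma letter_sum_mul u v : reduced_word u -> reduced_word v ->
  (`|letter_sum (foldr (@fpcons _ _) v u) - letter_sum u - letter_sum v|
     <= 1)%R.
Proof.
elim/last_ind: u v => [|u x IHu] [|y v] ru rv.
- by rewrite /letter_sum !big_nil.
- rewrite {2}/letter_sum big_nil /=; lia.
- rewrite foldr_fpcons_cat ?cats0 // {3}/letter_sum big_nil; lia.
have ru' : reduced_word u.
  by apply: (@reduced_word_prefix u [:: x]); rewrite cats1.
have rv' := reduced_word_behead rv.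
case: (boolP (Defs.is_left x == Defs.is_left y)) => [/eqP xy|xy]; last first.
  rewrite foldr_fpcons_cat ?letter_sum_cat; first lia.
  exact: reduced_word_cat xy ru rv.
rewrite -cats1 foldr_cat -[y :: v]cat1s !letter_sum_cat !letter_sum_seq1 /=.
case: x y xy ru rv => [a|b] [a'|b'] //= _ ru rv; case: eqP => [e|/eqP ne].
- have -> : a' = a^-1 by apply: (mulgI a); rewrite e mulgV.
  by have := IHu v ru' rv'; rewrite fV; lia.
- rewrite foldr_fpcons_cat; last first.
    by apply: reduced_word_replace ru rv => //; apply/eqP.
  rewrite -cat1s !letter_sum_cat letter_sum_seq1.
  by have := f_defect a a'; lia.
- have -> : b' = b^-1 by apply: (mulgI b); rewrite e mulgV.
  by have := IHu v ru' rv'; rewrite gV; lia.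
- rewrite foldr_fpcons_cat; last first.
    by apply: reduced_word_replace ru rv => //; apply/eqP.
  rewrite -cat1s !letter_sum_cat letter_sum_seq1.
  by have := g_defect b b'; lia.
Qed.

Lemma letter_sumV w : letter_sum (fpword w^-1) = (- letter_sum w)%R.
Proof.
rewrite /letter_sum /= -sumrN big_rev big_map /=.
by apply: eq_bigr => -[a|b] _ /=.
Qed.

(** A commutator x^-1 y^-1 x y is a product of four factors whose values add up to
    0, so each commutator adds at most 3 for its own multiplications and 1 for
    the multiplication with the others. *)
Lemma letter_sum_product c w : is_commutator_product c w ->
  (`|letter_sum w| <= 4 * c%:Z)%R.
Proof.
case=> s ->; elim: c s => [|c IHc] s.
  by rewrite tuple0 big_nil /letter_sum big_nil.
case/tupleP: s => -[x y] s; rewrite big_cons.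
have defect (p q : freeprod G H) :
    (`|letter_sum (p * q)%g - letter_sum p - letter_sum q| <= 1)%R.
  exact: letter_sum_mul (fpwordP p) (fpwordP q).
(* The seven values below are those at x, y, x * y, x ^ y, [~ x, y], the
   remaining product, and the whole product. *)
have arith (a b ab j k r t m : int) : (`|ab - a - b| <= 1 ->
    `|j - - b - ab| <= 1 -> `|k - - a - j| <= 1 -> `|t - k - r| <= 1 ->
    `|r| <= 4 * m -> `|t| <= 4 * (1 + m))%R by lia.
rewrite -[c.+1]add1n PoszD.
apply: arith (defect x y) _ _ (defect [~ x, y] _) (IHc s).
  by rewrite -letter_sumV; apply: (defect y^-1 (x * y)).
by rewrite -letter_sumV; apply: (defect x^-1 (x ^ y)).
Qed.

End Quasimorphism.

End FreeProducts.

(** * The generic word *)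

Section GenericWord.
Local Open Scope group_scope.

Notation F := (freeprod Zinfty Zinfty).
Notation inA := (@fpinl Zinfty Zinfty).
Notation inB := (@fpinr Zinfty Zinfty).
Notation nontrivial := (@nontrivial_pairs Zinfty Zinfty).
Notation word := (@alternating F {freeg nat} {freeg nat} inA inB).

Definition generic_letter n i : {freeg nat} :=
  (if (i < n)%N then << i >> else - \sum_(0 <= j < n) << j >>)%R.

(** On each side, n - 1 independent letters followed by the inverse of their
    product. *)
Definition generic_pairs n :=
  [seq (generic_letter n.-1 i, generic_letter n.-1 i) | i <- iota 0 n].

Lemma sgz_defect (x y : int) : (`|sgz (x + y) - sgz x - sgz y| <= 1)%R.
Proof. by case: (sgzP x); case: (sgzP y); case: (sgzP (x + y)); lia. Qed.

Lemma generic_letter_deg n i :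
  deg (generic_letter n i) = (if (i < n)%N then 1 else - n%:Z)%R.
Proof.
rewrite /generic_letter; case: ifP => _; first exact: degU.
rewrite degN raddf_sum /=; under eq_bigr do rewrite degU.
by rewrite sumr_const_nat subn0; lia.
Qed.

Lemma inAM : {morph inA : x y / (x + y)%R >-> x * y}.
Proof. exact: (@fpinlM Zinfty Zinfty). Qed.

Lemma inBM : {morph inB : x y / (x + y)%R >-> x * y}.
Proof. exact: (@fpinrM Zinfty Zinfty). Qed.

(** The homomorphisms to Zinfty that are the identity on one factor and trivial on
    the other vanish on commutators. *)
Lemma balanced_word s : derived_subgroup (word s) -> balanced s.
Proof.
move=> /cl_product ds.
have kill (h : F -> Zinfty) : {morph h : x y / x * y} ->
    \prod_(p <- s) (h (inA p.1) * h (inB p.2)) = 1.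
  move=> hM; have [t] := morph_commutator_product hM ds.
  rewrite /alternating (big_morph _ hM (morph1 hM)).
  under eq_bigr do rewrite hM.
  move=> ->; rewrite big1_seq // => pr _.
  by apply/eqP/commgP; apply: addrC.
have idM : {morph (fun x : Zinfty => x) : x y / x * y} by [].
have oneM : {morph (fun=> 1 : Zinfty) : x y / (x : Zinfty) * y}.
  by move=> x y; rewrite mulg1.
apply/andP; split; apply/eqP.
  rewrite -[RHS](kill _ (fpliftM idM oneM)).
  by apply: eq_bigr => p _; rewrite fplift_inl // fplift_inr // mulg1.
rewrite -[RHS](kill _ (fpliftM oneM idM)).
by apply: eq_bigr => p _; rewrite fplift_inl // fplift_inr // mul1g.
Qed.

Lemma generic_balanced n : balanced (generic_pairs n).
Proof.
have : (\sum_(0 <= i < n) generic_letter n.-1 i = 0)%R.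
  case: n => [|n]; first by rewrite big_nil.
  rewrite big_nat_recr //=.
  rewrite /generic_letter ltnn; apply/eqP; rewrite subr_eq0; apply/eqP.
  by apply: eq_big_nat => i /andP[_ ->].
rewrite /index_iota subn0 => sum0.
by rewrite /balanced !big_map /= sum0 eqxx.
Qed.

Lemma generic_nontrivial n : (1 < n)%N -> nontrivial (generic_pairs n).
Proof.
move=> n1; have nt i : generic_letter n.-1 i != 0%R.
  apply/eqP => /(congr1 (@deg _)); rewrite generic_letter_deg deg0.
  by case: ifP => //; lia.
by apply/allP => _ /mapP[i _ ->]; rewrite /= nt.
Qed.

Lemma word_words s : nontrivial s -> balanced s ->
  words (2 * size s) (word s).
Proof.
move=> nt_s bal_s; split.
- apply: derived_subgroup_product.
  exact: alternating_product (@inAM) (@inBM) _ bal_s.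
- by rewrite [fpword _]fpword_pairs // size_pairs_word.
exists (size s), (fun i => (tnth (in_tuple s) i).1),
  (fun i => (tnth (in_tuple s) i).2).
split=> [i|i|].
- by have /allP/(_ _ (mem_tnth i (in_tuple s)))/andP[] := nt_s.
- by have /allP/(_ _ (mem_tnth i (in_tuple s)))/andP[] := nt_s.
by rewrite /alternating (big_tnth _ _ s).
Qed.

Lemma words_word m w : words m w -> exists s,
  [/\ w = word s, m = (2 * size s)%N & balanced s].
Proof.
case=> dw <- [n [u [v [u1 v1 ew]]]].
pose s := [seq (u i, v i) | i <- index_enum 'I_n].
have ws : w = word s by rewrite ew /alternating big_map.
have nt_s : nontrivial s.
  by apply/allP => _ /mapP[i _ ->]; rewrite u1 v1.
have bal_s : balanced s by apply: balanced_word; rewrite -ws.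
by exists s; split=> //; have [_ <- _] := word_words nt_s bal_s; rewrite ws.
Qed.

HB.instance Definition _ (c : nat -> {freeg nat}) :=
  GRing.isZmodMorphism.Build {freeg nat} {freeg nat} (fglift c)
    (lift_is_additive c).

(** Since n - 1 of the generic letters are independent, they can be sent to
    prescribed elements; the last letter then goes to the right place because
    both words are balanced. *)
Lemma generic_image s : balanced s ->
  exists2 f : F -> F, {morph f : x y / x * y} &
    f (word (generic_pairs (size s))) = word s.
Proof.
move=> /andP[/eqP s1 /eqP s2].
have lift (c : nat -> {freeg nat}) n : (\sum_(0 <= i < n) c i = 0)%R ->
    exists2 h : Zinfty -> Zinfty, {morph h : x y / x * y} &
      forall i, (i < n)%N -> h (generic_letter n.-1 i) = c i.
  move=> c0; exists (fglift c) => [x y|i]; first exact: raddfD.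
  case: n c0 => // n c0; rewrite ltnS leq_eqVlt => /predU1P[->|lt_in].
    rewrite /generic_letter ltnn raddfN raddf_sum /=.
    under eq_bigr do rewrite liftU scale1r.
    move: c0; rewrite big_nat_recr //= addrC => /eqP.
    by rewrite addr_eq0 => /eqP.
  by rewrite /generic_letter lt_in liftU scale1r.
have [|h1 h1M h1E] := lift (fun i => (nth (0, 0)%R s i).1) (size s).
  by rewrite -(big_nth (0, 0)%R xpredT fst).
have [|h2 h2M h2E] := lift (fun i => (nth (0, 0)%R s i).2) (size s).
  by rewrite -(big_nth (0, 0)%R xpredT snd).
have lM : {morph (fun x : Zinfty => inA (h1 x)) : x y / x * y}.
  by move=> x y; rewrite h1M fpinlM.
have rM : {morph (fun x : Zinfty => inB (h2 x)) : x y / x * y}.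
  by move=> x y; rewrite h2M fpinrM.
exists (fplift (fun x => inA (h1 x)) (fun x => inB (h2 x))).
  exact: fpliftM.
have M := fpliftM lM rM.
rewrite /alternating (big_morph _ M (morph1 M)) big_map [RHS](big_nth (0, 0)%R).
rewrite /index_iota subn0 [LHS]big_seq [RHS]big_seq; apply: eq_bigr => i.
rewrite mem_iota /= add0n => lt_i.
by rewrite M fplift_inl // fplift_inr // h1E // h2E.
Qed.

Lemma scl_generic_ge (R : realType) n : (1 < n)%N ->
  (n%:R / 2 - 1 <= scl R (word (generic_pairs n)))%R.
Proof.
move=> n1; have nt := generic_nontrivial n1.
have [dw _ _] := word_words nt (generic_balanced n).
pose f (a : Zinfty) : int := sgz (deg a).
have fV a : f a^-1 = (- f a)%R by rewrite /f -sgzN -degN.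
have f_defect (a b : Zinfty) : (`|f (a * b)%g - f a - f b| <= 1)%R.
  by have := sgz_defect (deg a) (deg b); rewrite -degD.
have generic_sum :
    (\sum_(p <- generic_pairs n) (f p.1 + f p.2) = 2 * (n%:Z - 2))%R.
  rewrite big_map; case: n n1 {nt dw} => [|[|n]] // _.
  rewrite -[iota _ _]/(index_iota 0 n.+2) big_nat_recr //= /f.
  rewrite generic_letter_deg ltnn.
  rewrite (eq_big_nat _ _ (F2 := fun=> 2 : int)%R) => [|i /andP[_ lt_in]].
    by rewrite sumr_const_nat; lia.
  by rewrite generic_letter_deg lt_in.
have psi_word k :
    letter_sum f f (fpword (word (generic_pairs n) ^+ k)) =
    (k%:Z * (2 * (n%:Z - 2)))%R.
  have -> : word (generic_pairs n) ^+ k =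
      word (flatten (nseq k (generic_pairs n))).
    elim: k => [|k IHk]; first by rewrite /alternating big_nil.
    by rewrite expgS IHk /alternating /= big_cat.
  have nt_k : nontrivial (flatten (nseq k (generic_pairs n))).
    by elim: k => //= k IHk; rewrite /nontrivial_pairs all_cat; apply/andP.
  rewrite fpword_pairs // letter_sum_pairs {nt_k}.
  elim: k => [|k IHk]; first by rewrite big_nil mul0r.
  by rewrite /= big_cat /= IHk generic_sum; lia.
apply: scl_ge => // k.
have /(letter_sum_product fV fV f_defect f_defect) :=
  cl_product (derived_subgroupX k dw).
rewrite psi_word; set c := cl _ => psi_le.
have : (k * n <= 2 * k + 2 * c)%N by lia.
rewrite -(ler_nat R) natrD !natrM; lra.
Qed.

Lemma scl_generic_le (R : realType) n : (2 < n)%N ->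
  (scl R (word (generic_pairs n)) <=
     if n == 4%N then 7 / 6 else n%:R / 2 - 1)%R.
Proof.
move=> n2; have bal := generic_balanced n.
have sz : size (generic_pairs n) = n by rewrite size_map size_iota.
have dw : derived_subgroup (word (generic_pairs n)).
  exact: derived_subgroup_product (alternating_product (@inAM) (@inBM) bal).
case: eqVneq => n4.
  have w3 := alternating_cube (@inAM) (@inBM) bal (etrans sz n4).
  have := stable_bound_root (stable_bound_product w3).
  exact: scl_stable_bound.
have := alternating_stable_bound (@inAM) (@inBM) bal.
rewrite sz => /(_ n2 (elimN eqP n4)) /(@scl_stable_bound R _ _ dw _ 2 isT).
by rewrite natrB 1?ltnW // mulrBl divff.
Qed.

Lemma C_generic (R : realType) n : (1 < n)%N ->
  words (2 * n) (word (generic_pairs n)) /\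
  C R (2 * n) = (scl R (word (generic_pairs n)))%:E.
Proof.
move=> n1.
have sz : size (generic_pairs n) = n by rewrite size_map size_iota.
have gw : words (2 * n) (word (generic_pairs n)).
  rewrite -{1}sz; apply: word_words; last exact: generic_balanced.
  exact: generic_nontrivial.
split=> //; apply/eqP; rewrite eq_le; apply/andP; split.
  apply: ge_ereal_sup => _ [w /words_word [s [-> ns bal_s]] <-].
  have [g gM <-] := generic_image bal_s.
  have <- : n = size s by lia.
  rewrite lee_fin; apply: scl_morph => //.
  by case: gw.
by apply: ereal_sup_ubound; exists (word (generic_pairs n)).
Qed.

End GenericWord.

(** * The supremum *)

Theorem mainTheorem3 (R : realType) :
  (forall m n : nat, m = (2 * n)%N -> (4 < m)%N ->
     (exists2 w, words m w & (scl R w)%:E = C R m) /\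
     (C R m <= (if odd n then n%:R / 2 - 1
                else n%:R / 2 - ((n - 1)`!%:R - 1) /
                                (n%:R * (n - 2)`!%:R - 2))%:E)%E) /\
  (forall eps : R, 0 < eps ->
     \forall m \near \oo, ~~ odd m ->
       ((m%:R / 4 - 1)%:E <= C R m)%E /\
       (C R m <= (m%:R / 4 - 1 + eps)%:E)%E).
Proof.
split=> [m n -> m4 | eps eps0].
  have n1 : (1 < n)%N by lia.
  have n2 : (2 < n)%N by lia.
  have [gw Cn] := C_generic R n1.
  split.
    by exists (alternating (@fpinl Zinfty Zinfty) (@fpinr Zinfty Zinfty)
      (generic_pairs n)).
  rewrite Cn lee_fin (le_trans (scl_generic_le R n2)) //.
  case: eqVneq => [->|n4] /=.
    rewrite (_ : (4 - 1)`! = 6)%N // (_ : (4 - 2)`! = 2)%N //.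
    by rewrite (_ : 4 * 2 - 2 = 6 :> R); lra.
  (* It remains that the subtracted fraction is at most 1, that is,
     (n - 2)! >= 1. *)
  case: ifP => // _; rewrite lerD2l lerN2.
  have -> : (n - 1 = (n - 2).+1)%N by lia.
  have f1 : 1 <= (n - 2)`!%:R :> R by rewrite ler1n fact_gt0.
  have nR : n%:R = (n - 2).+1%:R + 1 :> R by rewrite natr1; congr _%:R; lia.
  have n3 : 3 <= n%:R :> R by rewrite (ler_nat _ 3).
  rewrite ler_pdivrMr; last by nra.
  rewrite mul1r factS natrM nR; nra.
near=> m => even_m.
have m8 : (8 < m)%N by near: m; exact: nbhs_infty_gt.
have [n mn] : exists n, m = (2 * n)%N by exists m./2; lia.
have n1 : (1 < n)%N by lia.
have n2 : (2 < n)%N by lia.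
have n4 : n != 4%N by lia.
have [_ Cn] := C_generic R n1.
rewrite mn Cn !lee_fin natrM.
have := scl_generic_ge R n1; have := scl_generic_le R n2.
by rewrite (negPf n4); lra.
Unshelve. all: end_near. Qed.
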